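(* Let $(U,\varphi)$ be a finite standard closure space whose lattice of closed sets is modular. Then the (aggregated) $E$-base of $(U,\varphi)$ is valid if and only if for every non-join-irreducible essential set $C$ and every predecessor $C'$ of $C$ one has $|C'\setminus C_*|=1$, where $C_*$ is the intersection of all predecessors of $C$.
   Context: A closure space $(U,\varphi)$ is a finite set $U$ with a closure operator $\varphi$ on $2^U$; closed sets $\mathcal{C}=\{C:\varphi(C)=C\}$ form a lattice under inclusion (join $\varphi(C_1\cup C_2)$, meet $\cap$). Standard: $\varphi(\{x\})\setminus\{x\}$ is closed for all $x\in U$. A predecessor of a closed set $C$ is a closed $C'\subsetneq C$ with no closed set strictly between; $C$ is join-irreducible if it has exactly one predecessor. A set $Q\subseteq U$ is quasi-closed if for every $X\subseteq Q$ with $\varphi(X)\subsetneq\varphi(Q)$ we have $\varphi(X)\subseteq Q$; $P$ is pseudo-closed if $P$ is not closed and is inclusion-minimal among quasi-closed sets $Q$ with $\varphi(Q)=\varphi(P)$; a closed set is essential if it equals $\varphi(P)$ for some pseudo-closed $P$. Binary part: $\varphi^b(X)=\bigcup_{x\in X}\varphi(\{x\})$. A $D$-generator of $x$ is $A\subseteq U$ with $x\in\varphi(A)$, $x\notin\varphi^b(A)$, and $x\notin\varphi(B)$ whenever $\varphi^b(B)\subsetneq\varphi^b(A)$; an $E$-generator of $x$ is a $D$-generator $A$ of $x$ with $\varphi(A)$ inclusion-minimal among closures of $D$-generators of $x$. Implications $A\to X$; a set $\Sigma$ of them induces the closure operator whose closed sets $C$ satisfy: $A\subseteq C\Rightarrow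 X\subseteq C$ for all $A\to X\in\Sigma$. The $E$-base is $\Sigma_E=\{a\to x: x\neq a, x\in\varphi(\{a\})\}\cup\{A\to x: A \text{ an } E\text{-generator of } x\}$ (aggregated: implications with equal premises merged); it is valid if its induced closure operator equals $\varphi$. *)

(* Defs.v *)
From mathcomp Require Import all_boot.

Set Implicit Arguments.
Unset Strict Implicit.
Unset Printing Implicit Defensive.

Section ClosureSpace.

Variables (U : finType) (phi : {set U} -> {set U}).
Implicit Types (x : U) (A B C P Q X : {set U}).

Definition closure_operator : Prop :=
  [/\ forall X, X \subset phi X,
      forall X Y : {set U}, X \subset Y -> phi X \subset phi Y
    & forall X, phi (phi X) = phi X].

Definition closed C : bool := phi C == C.

Definition standard : Prop := forall x, closed (phi [set x] :\ x).

Definition join C1 C2 : {set U} := phi (C1 :|: C2).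

Definition modular_closed_lattice : Prop :=
  forall C1 C2 C3, closed C1 -> closed C2 -> closed C3 -> C1 \subset C3 ->
    join C1 (C2 :&: C3) = join C1 C2 :&: C3.

Definition predecessor C C' : bool :=
  [&& closed C', C' \proper C
    & [forall D : {set U}, closed D ==> ~~ ((C' \proper D) && (D \proper C))]].

Definition predecessors C : {set {set U}} := [set C' | predecessor C C'].

Definition join_irreducible C : bool := closed C && (#|predecessors C| == 1).

Definition predecessor_meet C : {set U} := \bigcap_(C' in predecessors C) C'.

Definition quasi_closed Q : bool :=
  [forall X : {set U},
    (X \subset Q) && (phi X \proper phi Q) ==> (phi X \subset Q)].

Definition pseudo_closed P : bool :=
  ~~ closed P && minset (fun Q => quasi_closed Q && (phi Q == phi P)) P.

Definition essential C : bool :=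
  closed C && [exists P : {set U}, pseudo_closed P && (C == phi P)].

Definition binary_part X : {set U} := \bigcup_(x in X) phi [set x].

Definition D_generator x A : bool :=
  [&& x \in phi A, x \notin binary_part A
    & [forall B : {set U},
        (binary_part B \proper binary_part A) ==> (x \notin phi B)]].

Definition E_generator x A : bool :=
  D_generator x A &&
  [forall B : {set U},
    D_generator x B ==> ~~ (phi B \proper phi A)].

Definition unit_E_base : {set {set U} * U} :=
  [set ([set p.1], p.2) | p : U * U & (p.2 != p.1) && (p.2 \in phi [set p.1])]
  :|: [set i : {set U} * U | E_generator i.2 i.1].

End ClosureSpace.

Section Implications.

Variable U : finType.
Implicit Types (Sigma : {set {set U} * {set U}}) (C X : {set U}).

(* (A, X) stands for the implication A -> X. *)
Definition satisfies Sigma C : bool :=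
  [forall i in Sigma, (i.1 \subset C) ==> (i.2 \subset C)].

Definition induced_closure Sigma X : {set U} :=
  \bigcap_(C : {set U} | satisfies Sigma C && (X \subset C)) C.

(* Implications A -> x with the same premise A become a single A -> X. *)
Definition aggregate (Gamma : {set {set U} * U}) : {set {set U} * {set U}} :=
  [set (i.1, [set x | (i.1, x) \in Gamma]) | i in Gamma].

Definition E_base (phi : {set U} -> {set U}) : {set {set U} * {set U}} :=
  aggregate (unit_E_base phi).

Definition valid_E_base (phi : {set U} -> {set U}) : Prop :=
  induced_closure (E_base phi) =1 phi.

End Implications.

(* Main.v *)
(** Write [C_*] for [predecessor_meet phi C].

    If the condition holds and a set [Q] obeys the E-base without being closed,
    cut [Q] down to [Q :&: phi X], with [X \subset Q] and [phi X] a smallest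
    closure not included in [Q]. This is quasi-closed, its closure [C] is
    essential, and the predecessors of [C] are the sets [C_* :|: [set x_i]].
    The set contains at least two of the [x_i], contains [C_*] by modularity,
    and two of the [x_i] form an E-generator of every other one, so it equals
    [C] after all.

    Conversely, if the E-base is valid, every quasi-closed [Q != C] spanning a
    non-join-irreducible [C] misses an [x] with an E-generator spanning [C].
    Minimality makes [x] prime below [C]: [x \in phi Y] and [phi Y \proper C]
    force [x] into the binary part of [Y]. By modularity [Q] contains two
    predecessors of [C], and primality of [x] forces all predecessors of [C] to
    meet pairwise in the same [N = C_*]. Then for each predecessor [D] the set
    [C :\: (D :\: N)] is again quasi-closed, so [D :\: N] contains a prime
    element, and by modularity it contains nothing else. *)
From mathcomp Require Import all_boot.
Require Import Defs.

Set Implicit Arguments.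
Unset Strict Implicit.
Unset Printing Implicit Defensive.

Section ClosureOperator.

Variables (U : finType) (phi : {set U} -> {set U}).
Hypothesis phi_closure : closure_operator phi.
Implicit Types (x y z : U) (A B C D P Q X Y : {set U}).

(** * Closure operators, closed sets and binary parts *)

Lemma sub_phi X : X \subset phi X.
Proof. by case: phi_closure. Qed.

Lemma phiS X Y : X \subset Y -> phi X \subset phi Y.
Proof. by case: phi_closure => _ + _; apply. Qed.

Lemma phiK X : phi (phi X) = phi X.
Proof. by case: phi_closure. Qed.

Lemma closed_phi X : closed phi (phi X).
Proof. by rewrite /closed phiK. Qed.

Lemma phi_subE X C : closed phi C -> (phi X \subset C) = (X \subset C).
Proof.
move=> /eqP clC; apply/idP/idP => [|/phiS]; last by rewrite clC.
exact: subset_trans (sub_phi X).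
Qed.

Lemma phi1_subE x C : closed phi C -> (phi [set x] \subset C) = (x \in C).
Proof. by move=> clC; rewrite phi_subE // sub1set. Qed.

Lemma mem_phi1 x : x \in phi [set x].
Proof. by rewrite -sub1set sub_phi. Qed.

Lemma phi_closedI X Y :
  closed phi Y -> phi (X :&: Y) \subset X -> closed phi (X :&: Y).
Proof.
move=> clY sX; rewrite /closed eqEsubset sub_phi andbT subsetI sX.
by rewrite phi_subE // subsetIr.
Qed.

Lemma closedI C D : closed phi C -> closed phi D -> closed phi (C :&: D).
Proof.
by move=> clC clD; apply: phi_closedI => //; rewrite phi_subE // subsetIl.
Qed.

Lemma binary_part_sub_phi X : binary_part phi X \subset phi X.
Proof.
apply/bigcupsP => x Xx.
by rewrite phi1_subE ?closed_phi // (subsetP (sub_phi X)).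
Qed.

Lemma sub_binary_part X : X \subset binary_part phi X.
Proof. by apply/subsetP => x Xx; apply/bigcupP; exists x; rewrite ?mem_phi1. Qed.

Lemma binary_partS X Y :
  X \subset binary_part phi Y -> binary_part phi X \subset binary_part phi Y.
Proof.
move=> sXY; apply/bigcupsP => x /(subsetP sXY)/bigcupP[y Yy xy].
apply: subset_trans (bigcup_sup y Yy); by rewrite phi1_subE ?closed_phi.
Qed.

(** * Predecessors as lower covers in the lattice of closed sets *)

Lemma predecessorP C D :
  reflect [/\ closed phi D, D \proper C &
             forall E : {set U}, closed phi E -> D \proper E -> E \proper C -> False]
          (predecessor phi C D).
Proof.
apply: (iffP and3P) => [[clD pD /forallP cov]|[clD pD cov]]; split=> //.
  by move=> E clE DE EC; have:= cov E; rewrite clE DE EC.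
by apply/forallP => E; apply/implyP => clE; apply/negP => /andP[]; apply: cov.
Qed.

Lemma predecessor_closed C D : predecessor phi C D -> closed phi D.
Proof. by case/predecessorP. Qed.

Lemma predecessor_proper C D : predecessor phi C D -> D \proper C.
Proof. by case/predecessorP. Qed.

Lemma predecessor_sub C D : predecessor phi C D -> D \subset C.
Proof. by move/predecessor_proper/proper_sub. Qed.

Lemma predecessor_eq C D E :
  predecessor phi C D -> closed phi E -> D \subset E -> E \proper C -> E = D.
Proof.
case/predecessorP=> clD _ cov clE DE EC; apply/eqP.
case: eqVneq => // nED; case: (cov E clE _ EC).
by rewrite properEneq eq_sym nED.
Qed.

Lemma predecessor_sub_eq C D E :
  predecessor phi C D -> predecessor phi C E -> D \subset E -> D = E.
Proof.
move=> pD pE DE; symmetry; apply: (predecessor_eq pD) => //.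
  exact: predecessor_closed pE.
exact: predecessor_proper pE.
Qed.

Lemma predecessor_join C D X :
  closed phi C -> predecessor phi C D -> X \subset C -> ~~ (X \subset D) ->
  phi (D :|: X) = C.
Proof.
move=> clC pD XC nXD.
have sC : phi (D :|: X) \subset C by rewrite phi_subE // subUset predecessor_sub.
apply/eqP; case: eqVneq => // neq.
move: nXD; rewrite -(predecessor_eq pD (closed_phi (D :|: X))).
- by rewrite (subset_trans _ (sub_phi _)) ?subsetUr.
- by rewrite (subset_trans _ (sub_phi _)) ?subsetUl.
- by rewrite properEneq neq.
Qed.

Lemma predecessor_exists C X :
  closed phi C -> phi X \proper C -> exists2 D, predecessor phi C D & X \subset D.
Proof.
move=> clC XC.
have [|D /maxsetP[/andP[clD DC] maxD] XD] :=
  @maxset_exists _ (fun D => closed phi D && (D \proper C)) (phi X).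
  by rewrite closed_phi.
exists D; last exact: subset_trans (sub_phi X) XD.
apply/predecessorP; split=> // E clE DE EC.
have ED : E = D by apply: maxD; rewrite ?clE ?EC ?proper_sub.
by rewrite ED properxx in DE.
Qed.

(** * Generators and prime elements *)

Lemma D_generator_exists x Y :
  x \in phi Y -> x \notin binary_part phi Y ->
  exists2 B, D_generator phi x B & phi B \subset phi Y.
Proof.
move=> xY xbY.
pose p B := (binary_part phi B \subset binary_part phi Y) && (x \in phi B).
have pY : p Y by rewrite /p subxx.
(* A set generating [x] with a strictly smaller binary part would again be a candidate, so the
   minimum is a [D_generator]. *)
case: (arg_minnP (fun B => #|binary_part phi B|) pY) => B /andP[bB xB] minB.
exists B; last first.
  rewrite phi_subE ?closed_phi //; apply: subset_trans (sub_binary_part B) _.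
  exact: subset_trans bB (binary_part_sub_phi Y).
apply/and3P; split=> //; first by apply: contra xbY; apply: subsetP.
apply/forallP => A; apply/implyP => AB; apply/negP => xA.
have /minB : p A by rewrite /p xA andbT (subset_trans (proper_sub AB)).
by rewrite leqNgt proper_card.
Qed.

(** A local form of join-primality: if [phi [set x]] lies below a join of sets [phi [set y]] and
    that join is strictly below [C], it lies below one of them. *)
Definition prime_below C x :=
  forall Y, phi Y \proper C -> x \in phi Y -> x \in binary_part phi Y.

(** A failure at [Y] would yield a D-generator of [x] with closure inside [phi Y], strictly below
    [phi A], against minimality. *)
Lemma E_generator_prime x A : E_generator phi x A -> prime_below (phi A) x.
Proof.
case/andP=> _ /forallP minA Y YA xY; apply/negPn/negP => xbY.
have [B DB BY] := D_generator_exists xY xbY.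
by have:= minA B; rewrite DB (sub_proper_trans BY YA).
Qed.

(** * Quasi-closed and essential sets *)

Lemma quasi_closedP Q :
  reflect (forall X, X \subset Q -> phi X \proper phi Q -> phi X \subset Q)
          (quasi_closed phi Q).
Proof.
apply: (iffP forallP) => [q X XQ XpQ|q X]; last by apply/implyP => /andP[]; apply: q.
by have:= q X; rewrite XQ XpQ.
Qed.

(** A minimal quasi-closed [P] inside [Q] with the same closure is pseudo-closed: were it closed,
    [phi Q = P] would be included in [Q]. *)
Lemma quasi_closed_essential Q :
  quasi_closed phi Q -> ~~ closed phi Q -> essential phi (phi Q).
Proof.
move=> qQ nclQ; apply/andP; split; first exact: closed_phi.
have [|P minP PQ] := @minset_exists _ (fun P => quasi_closed phi P && (phi P == phi Q)) Q.
  by rewrite qQ /=.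
have [/andP[qP /eqP PE] _] := minsetP minP.
apply/existsP; exists P; rewrite PE eqxx andbT /pseudo_closed; apply/andP; split.
  apply: contra nclQ => /eqP clP; rewrite /closed eqEsubset sub_phi andbT.
  by rewrite -PE clP.
by rewrite PE.
Qed.

Lemma essential_quasi_closed C :
  essential phi C ->
  exists P, [/\ quasi_closed phi P, phi P = C & P != C].
Proof.
case/andP=> _ /existsP[P /andP[/andP[nclP /minsetP[/andP[qP _] _]] /eqP CE]].
by exists P; split=> //; rewrite CE eq_sym.
Qed.

(** * Models of the E-base *)

Lemma satisfies_E_baseP Q :
  reflect ((forall x y, x \in Q -> y \in phi [set x] -> y \in Q) /\
           (forall x A, E_generator phi x A -> A \subset Q -> x \in Q))
          (satisfies (E_base phi) Q).
Proof.
apply: (iffP forallP) => [sat|[bin gen] [A X]]; last first.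
  apply/implyP => /imsetP[[A' x'] _ [-> ->]] /=; apply/implyP => AQ.
  apply/subsetP => x; rewrite inE => /setUP[/imsetP[[a b]]|].
    rewrite inE /= => /andP[_ ba] [Aa ->]; apply: (bin a) => //.
    by rewrite -sub1set -Aa.
  by rewrite inE /= => /gen; apply.
have satU A x : (A, x) \in unit_E_base phi -> A \subset Q -> x \in Q.
  move=> Ax AQ.
  have := sat (A, [set y | (A, y) \in unit_E_base phi]).
  rewrite AQ /= => /implyP/(_ _)/subsetP; apply; last by rewrite inE.
  by apply/imsetP; exists (A, x).
split=> [x y xQ yx|x A EA]; last by apply: satU; rewrite !inE EA orbT.
have [->//|nyx] := eqVneq y x.
apply: (satU [set x]); last by rewrite sub1set.
by rewrite inE; apply/orP; left; apply/imsetP; exists (x, y); rewrite ?inE /= ?nyx.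
Qed.

Lemma closed_satisfies C : closed phi C -> satisfies (E_base phi) C.
Proof.
move=> clC; apply/satisfies_E_baseP; split=> [x y xC|x A /andP[/and3P[xA _ _] _] AC].
  by apply: subsetP; rewrite phi1_subE.
by apply: (subsetP _ _ xA); rewrite phi_subE.
Qed.

(** Closed sets always satisfy the E-base, so validity only asks that there be no further models. *)
Lemma valid_E_baseP :
  valid_E_base phi <-> (forall Q, satisfies (E_base phi) Q -> closed phi Q).
Proof.
split=> [val Q satQ|clo X].
  rewrite /closed -val eqEsubset; apply/andP; split.
    by apply: bigcap_inf; rewrite satQ /=.
  by apply/bigcapsP => C /andP[].
apply/eqP; rewrite eqEsubset; apply/andP; split.
  by apply: bigcap_inf; rewrite closed_satisfies ?closed_phi // sub_phi.
by apply/bigcapsP => C /andP[/clo clC XC]; rewrite phi_subE.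
Qed.

(** * Standard closure spaces *)

Section Standard.

Hypothesis phi_standard : standard phi.

Lemma phi0 : phi set0 = set0.
Proof.
apply/setP => x; rewrite inE; apply/negP => x0.
have := phiS (sub0set (phi [set x] :\ x)).
by rewrite (eqP (phi_standard x)) => /subsetP/(_ _ x0); rewrite !inE eqxx.
Qed.

(** A closed set strictly inside [phi [set x]] omits [x], so [phi [set x] :\ x] is the greatest of
    them. *)
Lemma join_irreducible_phi1 x : join_irreducible phi (phi [set x]).
Proof.
rewrite /join_irreducible closed_phi /=.
suff -> : predecessors phi (phi [set x]) = [set phi [set x] :\ x] by rewrite cards1.
have pr : phi [set x] :\ x \proper phi [set x] by rewrite properD1 ?mem_phi1.
have sub D : closed phi D -> D \proper phi [set x] -> D \subset phi [set x] :\ x.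
  move=> clD /properP[Dx [y xy nDy]]; rewrite subsetD1 Dx /=.
  by apply: contra nDy => xD; apply: (subsetP _ _ xy); rewrite phi1_subE.
have px : predecessor phi (phi [set x]) (phi [set x] :\ x).
  apply/predecessorP; split=> // E clE /properP[_ [y yE nyx]] /(sub _ clE).
  by move/subsetP/(_ y yE); rewrite (negPf nyx).
apply/setP => D; rewrite !inE; apply/idP/eqP => [pD|->//].
apply: (predecessor_sub_eq pD px).
by apply: sub (predecessor_proper pD); apply: predecessor_closed pD.
Qed.

Lemma phi1_proper C x :
  closed phi C -> ~~ join_irreducible phi C -> x \in C -> phi [set x] \proper C.
Proof.
move=> clC njC xC; rewrite properEneq phi1_subE // xC andbT.
by apply: contra njC => /eqP <-; apply: join_irreducible_phi1.
Qed.

Lemma predecessor_containing C x :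
  closed phi C -> ~~ join_irreducible phi C -> x \in C ->
  exists2 D, predecessor phi C D & x \in D.
Proof.
move=> clC njC xC; have [D pD] := predecessor_exists clC (phi1_proper clC njC xC).
by rewrite sub1set; exists D.
Qed.

(** Not being closed, [Q] violates the E-base. The binary implications hold in [Q], since single
    elements span less than [C]; the violated one thus has an E-generator [A] as premise, and
    quasi-closedness forces [phi A = C]. *)
Lemma valid_prime_exists C Q :
  valid_E_base phi -> ~~ join_irreducible phi C ->
  quasi_closed phi Q -> phi Q = C -> Q != C ->
  exists x, [/\ x \in C, x \notin Q & prime_below C x].
Proof.
move=> /valid_E_baseP val njC qQ QC nQC.
have clC : closed phi C by rewrite -QC closed_phi.
have QsC : Q \subset C by rewrite -QC sub_phi.
have proper_in X : X \subset Q -> phi X != C -> phi X \subset Q.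
  move=> XQ nXC; apply: (quasi_closedP _ qQ) => //.
  by rewrite properEneq QC nXC -QC phiS.
pose bad := [exists A : {set U}, [exists x,
  [&& E_generator phi x A, A \subset Q & x \notin Q]]].
have [/existsP[A /existsP[x /and3P[EA AQ xQ]]]|nbad] := boolP bad.
  have xA : x \in phi A by case/andP: EA => /and3P[].
  have AC : phi A = C.
    apply/eqP/negPn/negP => /(proper_in _ AQ)/subsetP/(_ _ xA).
    by rewrite (negPf xQ).
  by exists x; rewrite -AC; split=> //; apply: E_generator_prime.
case/negP: nQC; rewrite eq_sym -QC; apply: val; apply/satisfies_E_baseP.
split=> [x y xQ|x A EA AQ].
  apply: subsetP; apply: proper_in; first by rewrite sub1set.
  by have/phi1_proper := subsetP QsC x xQ; rewrite properEneq => /(_ clC njC)/andP[].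
apply: contraR nbad => nxQ; apply/existsP; exists A; apply/existsP; exists x.
by rewrite EA AQ.
Qed.

End Standard.

(** * Modular lattices of closed sets *)

Section Modular.

Hypothesis phi_modular : modular_closed_lattice phi.

(** Exclusion of the pentagon: under these hypotheses the two sides of the modular law reduce to [B]
    and [D]. *)
Lemma modular_cancel A B D :
  closed phi A -> closed phi B -> closed phi D ->
  B \subset D -> A :&: D \subset B -> D \subset phi (B :|: A) -> D = B.
Proof.
move=> clA clB clD BD ADB Dj; have := phi_modular clB clA clD BD.
by rewrite /join (setUidPl ADB) (eqP clB) (setIidPr Dj).
Qed.

(** A closed set strictly between [C1 :&: C2] and [C2] has an element outside [C1], hence joins with
    [C1] to [C], and a pentagon appears. *)
Lemma predecessor_meet2 C C1 C2 :
  closed phi C -> predecessor phi C C1 -> predecessor phi C C2 -> C1 != C2 ->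
  predecessor phi C2 (C1 :&: C2).
Proof.
move=> clC p1 p2 n12.
have [cl1 cl2] := (predecessor_closed p1, predecessor_closed p2).
apply/predecessorP; split; first exact: closedI.
  rewrite properE subsetIr subsetI subxx andbT /=.
  by apply: contra n12 => /(predecessor_sub_eq p2 p1) ->.
move=> D clD /properP[ID [x xD nx]] /[dup] DpC2 /proper_sub DC2.
have E : C2 = D.
  apply: (modular_cancel cl1 clD cl2 DC2 ID).
  rewrite setUC (predecessor_join clC p1) ?(predecessor_sub p2) //.
    exact: subset_trans DC2 (predecessor_sub p2).
  apply/negP => /subsetP/(_ x xD) x1.
  by rewrite inE x1 (subsetP DC2) in nx.
by rewrite E properxx in DpC2.
Qed.

(** A maximal closed [B] inside [Q] through [x] is itself a predecessor. Take a predecessor [D]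
    above [B] and [y] in [Q] outside [D]: by maximality [B] and [phi [set y]] join to [C], and
    [modular_cancel] gives [D = B]. *)
Lemma quasi_closed_predecessor C Q x :
  standard phi -> ~~ join_irreducible phi C ->
  quasi_closed phi Q -> phi Q = C -> Q != C -> x \in Q ->
  exists D, [/\ predecessor phi C D, D \subset Q & x \in D].
Proof.
move=> std njC qQ QC nQC xQ.
have clC : closed phi C by rewrite -QC closed_phi.
have QsC : Q \subset C by rewrite -QC sub_phi.
have qc X : X \subset Q -> phi X \proper C -> phi X \subset Q.
  by move: qQ => /quasi_closedP; rewrite QC; apply.
have xpC : phi [set x] \proper C by apply: phi1_proper => //; apply: subsetP xQ.
have [|B /maxsetP[/andP[clB BQ] maxB] xB] :=
  @maxset_exists _ (fun B => closed phi B && (B \subset Q)) (phi [set x]).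
  by rewrite closed_phi qc // sub1set.
have BpC : phi B \proper C.
  rewrite (eqP clB); apply: sub_proper_trans BQ _.
  by rewrite properEneq nQC.
have [D pD BD] := predecessor_exists clC BpC.
have clD := predecessor_closed pD.
(* [Q :&: D] spans at most [D], so quasi-closedness makes it closed and maximality of [B]
   applies. *)
have QDB : Q :&: D = B.
  apply: maxB; last by rewrite subsetI BQ BD.
  rewrite subsetIl andbT; apply: phi_closedI => //; apply: qc; first exact: subsetIl.
  by apply: sub_proper_trans (predecessor_proper pD); rewrite phi_subE // subsetIr.
have /subsetPn[y yQ nyD] : ~~ (Q \subset D).
  apply/negP; rewrite -(phi_subE _ clD) QC => CD.
  by have := predecessor_proper pD; rewrite properE CD andbF.
suff DB : D = B.
  by exists D; rewrite pD; split=> //; rewrite DB // (subsetP xB) ?mem_phi1.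
have yC : phi [set y] \subset C by rewrite phi1_subE // (subsetP QsC).
apply: (modular_cancel (closed_phi [set y])) => //.
  rewrite -QDB setSI // qc ?sub1set //.
  by apply: phi1_proper => //; apply: subsetP yQ.
set J := phi _.
have JC : J \subset C.
  by rewrite phi_subE // subUset yC andbT (subset_trans BQ).
have BJ : B \subset J by rewrite (subset_trans _ (sub_phi _)) ?subsetUl.
have yJ : y \in J.
  by rewrite (subsetP (sub_phi _)) // inE mem_phi1 orbT.
(* If [J] is not [C], it lies in [Q], so it equals [B] although it contains [y]. *)
have [->|nJC] := eqVneq J C; first exact: predecessor_sub.
have JQ : J \subset Q.
  have JE : J = phi (y |: B).
    have sy := sub_phi (y |: B); rewrite subUset in sy; case/andP: sy => yJ' BJ'.
    apply/eqP; rewrite eqEsubset !phi_subE ?closed_phi // !subUset BJ' BJ.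
    by rewrite phi_subE ?closed_phi // yJ' sub1set yJ.
  by rewrite JE; apply: qc; rewrite -?JE ?properEneq ?nJC // subUset sub1set yQ.
have JB : J = B by apply: maxB; rewrite ?closed_phi.
by case/negP: nyD; apply: (subsetP BD); rewrite -JB.
Qed.

(* Covering plus primality of [x]: adjoining to [C3 :&: C1] an element of
   [C3 :&: C2] outside [C1] would generate [x] from below. *)
Lemma prime_meet_sub C C1 C2 C3 x :
  closed phi C -> prime_below C x ->
  predecessor phi C C1 -> predecessor phi C C2 -> predecessor phi C C3 ->
  x \notin C1 -> x \notin C2 -> x \in C3 -> C3 :&: C2 \subset C1.
Proof.
move=> clC prx p1 p2 p3 x1 x2 x3; apply/subsetP => u /setIP[u3 u2].
apply/negPn/negP => u1.
have n13 : C1 != C3 by apply: contraNneq x1 => ->.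
have p13 := predecessor_meet2 clC p1 p3 n13.
have J3 : phi ((C1 :&: C3) :|: [set u]) = C3.
  apply: predecessor_join (predecessor_closed p3) p13 _ _; rewrite sub1set //.
  by rewrite inE (negPf u1).
have := prx ((C1 :&: C3) :|: [set u]); rewrite J3 => /(_ (predecessor_proper p3) x3).
case/bigcupP => v /setUP[/setIP[v1 _]|/set1P ->] xv.
  case/negP: x1; apply: (subsetP _ _ xv).
  by rewrite phi1_subE ?(predecessor_closed p1).
case/negP: x2; apply: (subsetP _ _ xv).
by rewrite phi1_subE ?(predecessor_closed p2).
Qed.

(** Both intersections are predecessors of [C1], so the inclusion from [prime_meet_sub] is an
    equality. *)
Lemma prime_meet_eq C C1 C2 C3 x :
  closed phi C -> prime_below C x ->
  predecessor phi C C1 -> predecessor phi C C2 -> predecessor phi C C3 ->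
  x \notin C1 -> x \notin C2 -> x \in C3 -> C1 != C2 -> C3 :&: C1 = C1 :&: C2.
Proof.
move=> clC prx p1 p2 p3 x1 x2 x3 n12.
have s2 := prime_meet_sub clC prx p2 p1 p3 x2 x1 x3.
have n31 : C3 != C1 by apply: contraNneq x1 => <-.
have n21 : C2 != C1 by rewrite eq_sym.
have p31 := predecessor_meet2 clC p3 p1 n31.
have p21 := predecessor_meet2 clC p2 p1 n21.
rewrite (setIC C1 C2); apply: (predecessor_sub_eq p31 p21).
by rewrite subsetI s2 subsetIr.
Qed.

(** The set [C1 :&: C2] lies in every predecessor [D]: if [x] is not in [D], compare [C1 :&: C2] and
    [C1 :&: D] with [C3 :&: C1] for a predecessor [C3] through [x]. *)
Lemma prime_predecessor_meet C C1 C2 x :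
  standard phi -> closed phi C -> ~~ join_irreducible phi C ->
  x \in C -> prime_below C x ->
  predecessor phi C C1 -> predecessor phi C C2 -> C1 != C2 ->
  x \notin C1 -> x \notin C2 ->
  forall D, predecessor phi C D -> predecessor phi D (predecessor_meet phi C).
Proof.
move=> std clC njC xC prx p1 p2 n12 x1 x2.
have [C3 p3 x3] := predecessor_containing std clC njC xC.
have sub D : predecessor phi C D -> C1 :&: C2 \subset D.
  move=> pD; have [xD|xD] := boolP (x \in D).
    by rewrite -(prime_meet_eq clC prx p1 p2 pD) // subsetIl.
  have [->|nD1] := eqVneq D C1; first exact: subsetIl.
  rewrite -(prime_meet_eq clC prx p1 p2 p3) //.
  by rewrite (prime_meet_eq clC prx p1 pD p3) ?subsetIr // eq_sym.
have -> : predecessor_meet phi C = C1 :&: C2.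
  apply/eqP; rewrite eqEsubset subsetI !bigcap_inf ?inE //=.
  by apply/bigcapsP => D; rewrite inE => /sub.
have p21 : predecessor phi C1 (C1 :&: C2).
  by rewrite setIC; apply: predecessor_meet2 clC p2 p1 _; rewrite eq_sym.
move=> D pD; have [->//|nD1] := eqVneq D C1.
have pD1 := predecessor_meet2 clC pD p1 nD1.
rewrite (predecessor_sub_eq p21 pD1); last by rewrite subsetI sub // subsetIl.
by rewrite setIC; apply: predecessor_meet2 clC p1 pD _; rewrite eq_sym.
Qed.

(** A second element [z] spans [D] together with [N], so primality puts [x] in [phi [set z] :\ z].
    This closed set then has the same join with [N] as [phi [set z]], and the same meet since [z] is
    not in [N]: a pentagon. *)
Lemma prime_unique C N D x :
  standard phi -> closed phi C -> predecessor phi C D -> predecessor phi D N ->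
  x \in D :\: N -> prime_below C x -> D :\: N = [set x].
Proof.
move=> std clC pD pN /setDP[xD xN] prx.
have [clD clN] := (predecessor_closed pD, predecessor_closed pN).
apply/setP => z; rewrite in_set1; apply/idP/eqP => [/setDP[zD zN]|->];
  last by rewrite inE xN.
apply/eqP/negPn/negP => nzx.
have JD y : y \in D -> y \notin N -> phi (N :|: [set y]) = D.
  by move=> yD yN; apply: predecessor_join => //; rewrite sub1set.
have xz : x \in phi [set z] :\ z.
  rewrite !inE eq_sym nzx /=.
  have := prx (N :|: [set z]); rewrite JD // => /(_ (predecessor_proper pD) xD).
  case/bigcupP => v /setUP[vN|/set1P -> //] xv; case/negP: xN.
  by apply: (subsetP _ _ xv); rewrite phi1_subE.
have E : phi [set z] = phi [set z] :\ z.
  apply: (modular_cancel clN (std z) (closed_phi _) (subD1set _ _)).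
    rewrite subsetD1 subsetIr inE (negPf zN) //.
  have zsD : phi [set z] \subset D by rewrite phi1_subE.
  apply: subset_trans zsD _.
  rewrite -(JD x) // setUC phiS // setSU // sub1set //.
by have := mem_phi1 z; rewrite E !inE eqxx.
Qed.

(** * Necessity of the cardinality condition *)

Lemma valid_predecessor_card1 C D :
  standard phi -> valid_E_base phi -> essential phi C ->
  ~~ join_irreducible phi C -> predecessor phi C D ->
  #|D :\: predecessor_meet phi C| = 1.
Proof.
move=> std val essC njC pD.
have clC : closed phi C by case/andP: essC.
have [P [qP PC nPC]] := essential_quasi_closed essC.
have [x [xC xP prx]] := valid_prime_exists std val njC qP PC nPC.
have [y0 y0P] : exists y, y \in P.
  by apply/set0Pn; apply: contraNneq nPC => P0; rewrite -PC P0 phi0.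
have [C1 [p1 s1 _]] := quasi_closed_predecessor std njC qP PC nPC y0P.
(* As [P] spans [C], it leaves [C1]; an element outside [C1] leads to a second predecessor inside
   [P]. *)
have /subsetPn[y yP ny1] : ~~ (P \subset C1).
  apply/negP; rewrite -(phi_subE _ (predecessor_closed p1)) PC => s.
  by have := predecessor_proper p1; rewrite properE s andbF.
have [C2 [p2 s2 y2]] := quasi_closed_predecessor std njC qP PC nPC yP.
have n12 : C1 != C2 by apply: contraNneq ny1 => ->.
have x1 : x \notin C1 by apply: contra xP; apply: subsetP.
have x2 : x \notin C2 by apply: contra xP; apply: subsetP.
have := prime_predecessor_meet std clC njC xC prx p1 p2 n12 x1 x2.
set N := predecessor_meet phi C => pN.
have NS E : predecessor phi C E -> N \subset E by move/pN/predecessor_sub.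
have meet E : predecessor phi C E -> E != D -> E :&: D = N.
  move=> pE nED; apply: (predecessor_eq (pN _ pE)).
  - by apply: closedI; apply: predecessor_closed; eassumption.
  - by rewrite subsetI !NS.
  - rewrite setIC; apply: predecessor_proper; apply: predecessor_meet2 clC pD pE _.
    by rewrite eq_sym.
pose Q := C :\: (D :\: N).
have QD : Q :&: D \subset N.
  apply/subsetP => z; rewrite !inE => /andP[/andP[]].
  by case: (z \in N) => //= + _; case: (z \in D).
have EQ E : predecessor phi C E -> E != D -> E \subset Q.
  move=> pE nED; apply/subsetP => z zE.
  rewrite !inE (subsetP (predecessor_sub pE)) //= andbT negb_and negbK orbC -implybE; apply/implyP => zD.
  by rewrite -(meet E) // inE zE.
have NQ : N \subset Q.
  apply/subsetP => z zN; rewrite !inE zN /=.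
  exact: (subsetP (subset_trans (NS _ p1) (predecessor_sub p1))).
have QsC : Q \subset C by rewrite subsetDl.
(* Otherwise every predecessor other than [D] equals [E]. As [C1] and [C2] differ, one of them is
   [D] and the other [E]; both omit [x], which therefore lies in [Q] but not in [E]. *)
have nQ E : predecessor phi C E -> ~~ (Q \subset E).
  move=> pE; apply/negP => QE.
  have other F : predecessor phi C F -> F != D -> F = E.
    move=> pF nFD; apply: (predecessor_sub_eq pF pE).
    by apply: subset_trans (EQ _ pF nFD) QE.
  have [C1D|nC1D] := eqVneq C1 D; last have [C2D|nC2D] := eqVneq C2 D.
  - have nC2D : C2 != D by rewrite -C1D eq_sym.
    have C2E := other _ p2 nC2D.
    (* [Q \subset E = C2] forces [C = C1 :|: C2], excluded by [x]. *)
    have xQ : x \in Q by rewrite !inE xC -C1D (negPf x1) andbF.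
    by move/subsetP/(_ x xQ): QE; rewrite -C2E (negPf x2).
  - have C1E := other _ p1 nC1D.
    have xQ : x \in Q by rewrite !inE xC -C2D (negPf x2) andbF.
    by move/subsetP/(_ x xQ): QE; rewrite -C1E (negPf x1).
  - by move/negP: n12; apply; rewrite (other _ p1) // (other _ p2).
have QC : phi Q = C.
  apply/eqP/negPn/negP => nQC.
  have [|E pE QE] := @predecessor_exists C Q clC.
    by rewrite properEneq nQC phi_subE.
  by rewrite (negPf (nQ _ pE)) in QE.
have nQC : Q != C.
  have /properP[_ [z zD zN]] := predecessor_proper (pN _ pD).
  apply/eqP => QE; have := subsetP (predecessor_sub pD) z zD.
  by rewrite -QE !inE zD zN.
(* A subset of [Q] spanning less than [C] lies in a predecessor: one other than [D] is included in
   [Q], while [D] meets [Q] only in [N]. *)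
have qQ : quasi_closed phi Q.
  apply/quasi_closedP => X XQ; rewrite QC => /(predecessor_exists clC)[E pE XE].
  have [ED|nED] := eqVneq E D; last first.
    apply: subset_trans (EQ _ pE nED); by rewrite phi_subE ?(predecessor_closed pE).
  apply: subset_trans NQ; rewrite phi_subE ?(predecessor_closed (pN _ pD)) //.
  by apply: subset_trans QD; rewrite subsetI XQ -ED.
have [z [zC zQ prz]] := valid_prime_exists std val njC qQ QC nQC.
rewrite (@prime_unique C N D z) ?cards1 //; first exact: pN.
by move: zQ; rewrite inE zC andbT negbK.
Qed.

(** * Sufficiency of the cardinality condition *)

Lemma predecessor_card1_quasi_closed C Q :
  standard phi -> ~~ join_irreducible phi C ->
  (forall D, predecessor phi C D -> #|D :\: predecessor_meet phi C| = 1) ->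
  satisfies (E_base phi) Q -> quasi_closed phi Q -> phi Q = C -> Q = C.
Proof.
move=> std njC card1 /satisfies_E_baseP[_ gen] qQ QC.
have clC : closed phi C by rewrite -QC closed_phi.
have QsC : Q \subset C by rewrite -QC sub_phi.
apply/eqP/negPn/negP => nQC.
set N := predecessor_meet phi C in card1.
have NS E : predecessor phi C E -> N \subset E.
  by move=> pE; apply: bigcap_inf; rewrite inE.
(* A predecessor is [N] plus one point, so any element outside [N] determines it. *)
have atom E x : predecessor phi C E -> x \in E -> x \notin N -> E = x |: N.
  move=> pE xE xN; have /eqP/cards1P[y Ey] := card1 E pE.
  have : x \in E :\: N by rewrite inE xN.
  rewrite Ey => /set1P xy; rewrite xy -Ey setUC setDE setUIr setUCr setIT.
  by rewrite (setUidPr (NS _ pE)).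
have [y0 y0P] : exists y, y \in Q.
  by apply/set0Pn; apply: contraNneq nQC => P0; rewrite -QC P0 phi0.
have [C1 [p1 s1 _]] := quasi_closed_predecessor std njC qQ QC nQC y0P.
have NQ : N \subset Q := subset_trans (NS _ p1) s1.
have nQ E : predecessor phi C E -> exists2 y, y \in Q & y \notin E.
  move=> pE; apply/subsetPn.
  apply/negP; rewrite -(phi_subE _ (predecessor_closed pE)) QC => s.
  by have := predecessor_proper pE; rewrite properE s andbF.
have [x2 x2Q x21] := nQ _ p1.
have [C2 p2 x22] := predecessor_containing std clC njC (subsetP QsC x2 x2Q).
have x2N : x2 \notin N by apply: contra x21; apply: subsetP; apply: NS.
have C2E := atom _ _ p2 x22 x2N.
have [x1 x1Q x12] := nQ _ p2.
have [C1' p1' x11] := predecessor_containing std clC njC (subsetP QsC x1 x1Q).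
have x1N : x1 \notin N by apply: contra x12; apply: subsetP; apply: NS.
have C1E := atom _ _ p1' x11 x1N.
have n21 : x2 != x1 by apply: contraNneq x12 => <-.
have /properP[_ [x3 x3C x3Q]] : Q \proper C by rewrite properEneq nQC.
have [C3 p3 x33] := predecessor_containing std clC njC x3C.
have x3N : x3 \notin N by apply: contra x3Q; apply: subsetP.
have C3E := atom _ _ p3 x33 x3N.
have n31 : x3 != x1 by apply: contraNneq x3Q => ->.
have n32 : x3 != x2 by apply: contraNneq x3Q => ->.
have clN : closed phi N.
  have -> : N = C2 :&: C3.
    apply/setP => z; rewrite C2E C3E !inE; case: (z \in N); rewrite ?orbT ?orbF //=.
    by have [->|//] := eqVneq z x2; rewrite eq_sym (negPf n32).
  exact: closedI (predecessor_closed p2) (predecessor_closed p3).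
have x12C : [set x1; x2] \subset C.
  by rewrite subUset !sub1set !(subsetP QsC).
(* A predecessor containing [x1] is [x1 |: N], which omits [x2]. *)
have spanC B : x1 \in B -> x2 \in B -> B \subset C -> phi B = C.
  move=> x1B x2B BC; apply/eqP/negPn/negP => neq.
  have [|E pE BE] := @predecessor_exists C B clC.
    by rewrite properEneq neq phi_subE.
  have := subsetP BE x2 x2B.
  by rewrite (atom _ _ pE (subsetP BE _ x1B) x1N) !inE (negPf n21) (negPf x2N).
have phi12 : phi [set x1; x2] = C by apply: spanC; rewrite ?inE ?eqxx ?orbT.
have bin12 : binary_part phi [set x1; x2] \subset [set x1; x2] :|: N.
  apply/bigcupsP => z /set2P[] ->; [have sub := x11 | have sub := x22];
  rewrite -?(phi1_subE _ (predecessor_closed p1'))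
          -?(phi1_subE _ (predecessor_closed p2)) in sub;
  apply: subset_trans sub _; rewrite ?C1E ?C2E;
  by apply/subsetP => w; rewrite !inE => /orP[/eqP ->|->]; rewrite ?eqxx ?orbT.
case/negP: x3Q; apply: (gen _ [set x1; x2]); last by rewrite subUset !sub1set x1Q.
apply/andP; split; last first.
  (* A D-generator [B] of [x3] spanning less than [C] lies in [x3 |: N]. It omits [x3], so it lies
     in the closed set [N], which cannot generate [x3]. *)
  apply/forallP => B; apply/implyP => /and3P[x3B x3b _]; rewrite phi12.
  apply/negP => /(predecessor_exists clC)[E pE BE].
  have x3E : x3 \in E.
    by apply: (subsetP _ _ x3B); rewrite phi_subE ?(predecessor_closed pE).
  case/negP: (x3N); apply: (subsetP _ _ x3B); rewrite phi_subE //.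
  apply/subsetP => z zB; have := subsetP BE z zB.
  rewrite (atom _ _ pE x3E x3N) => /setU1P[zx3|//].
  by case/negP: x3b; rewrite -zx3 (subsetP (sub_binary_part B)).
apply/and3P; split; first by rewrite phi12.
  apply/negP => /(subsetP bin12); rewrite !inE.
  by rewrite (negPf n31) (negPf n32) (negPf x3N).
(* A strictly smaller binary part means that [B] misses [x1] or [x2]; then [B] lies in [C2] or
   [C1'], neither of which contains [x3]. *)
apply/forallP => B; apply/implyP => /properP[sb [w wb nw]].
have BS : B \subset [set x1; x2] :|: N.
  by apply: subset_trans (sub_binary_part B) _; apply: subset_trans sb bin12.
have miss y E : closed phi E -> x3 \notin E -> [set x1; x2] :|: N \subset y |: E ->
    y \notin B -> x3 \notin phi B.
  move=> clE x3E sE yB; apply: contra x3E; apply: subsetP; rewrite phi_subE //.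
  apply/subsetP => z zB; have := subsetP (subset_trans BS sE) z zB.
  by case/setU1P => // zy; rewrite -zy zB in yB.
have [x1B|] := boolP (x1 \in B); last first.
  apply: (miss _ C2) (predecessor_closed p2) _ _; rewrite C2E.
    by rewrite !inE (negPf n32).
  by rewrite setUA.
apply: (miss _ C1') (predecessor_closed p1') _ _ _; rewrite ?C1E.
- by rewrite !inE (negPf n31).
- by rewrite setUCA setUA.
apply: contra nw => x2B; apply: subsetP wb; apply: binary_partS.
by rewrite subUset !sub1set !(subsetP (sub_binary_part B)).
Qed.

Lemma predecessor_card1_valid :
  standard phi ->
  (forall C, essential phi C -> ~~ join_irreducible phi C ->
   forall D, predecessor phi C D -> #|D :\: predecessor_meet phi C| = 1) ->
  valid_E_base phi.
Proof.
move=> std card1; apply/valid_E_baseP => Q satQ; apply/negPn/negP => nclQ.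
have /satisfies_E_baseP[bQ gQ] := satQ.
have pQ : (Q \subset Q) && ~~ (phi Q \subset Q).
  by rewrite subxx; apply: contra nclQ => s; rewrite /closed eqEsubset s sub_phi.
pose p X := (X \subset Q) && ~~ (phi X \subset Q).
case: (@arg_minnP _ _ p (fun X => #|phi X|) pQ) => X /andP[XQ nXQ] minX.
pose R := Q :&: phi X.
have XR : X \subset R by rewrite subsetI XQ sub_phi.
have RX : phi R = phi X.
  by apply/eqP; rewrite eqEsubset phi_subE ?closed_phi // subsetIr phiS.
have satR : satisfies (E_base phi) R.
  have /satisfies_E_baseP[bX gX] := closed_satisfies (closed_phi X).
  apply/satisfies_E_baseP; split=> [x y /setIP[xQ xX] yx|x A EA].
    by rewrite inE (bQ x y xQ yx) (bX x y xX yx).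
  by rewrite subsetI inE => /andP[AQ AX]; rewrite (gQ x A EA AQ) (gX x A EA AX).
have nRX : R != phi X.
  by apply: contra nXQ => /eqP <-; apply: subsetIl.
have qR : quasi_closed phi R.
  apply/quasi_closedP => Y YR; rewrite RX => YX.
  rewrite subsetI (proper_sub YX) andbT; apply/negPn/negP => nYQ.
  have /minX : p Y by rewrite /p nYQ andbT (subset_trans YR) ?subsetIl.
  by rewrite leqNgt proper_card.
have essX : essential phi (phi X).
  by rewrite -RX quasi_closed_essential // /closed RX eq_sym.
(* With a single predecessor [D], an element of [R] outside [D] spans [phi X] by itself, so the
   binary implications put [phi X] inside [Q]. *)
have njX : ~~ join_irreducible phi (phi X).
  apply/negP => /andP[_ /cards1P[D XD]].
  have pD : predecessor phi (phi X) D.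
    by have := set11 D; rewrite -XD inE.
  have clD := predecessor_closed pD.
  have /subsetPn[x xR xD] : ~~ (R \subset D).
    apply/negP; rewrite -(phi_subE _ clD) RX => s.
    by have := predecessor_proper pD; rewrite properE s andbF.
  case/negP: nRX; rewrite eqEsubset subsetIr subsetI subxx andbT.
  have xX : phi [set x] \subset phi X.
    by rewrite phi1_subE ?closed_phi //; case/setIP: xR.
  have [<-|nxX] := eqVneq (phi [set x]) (phi X).
    by apply/subsetP => y; apply: bQ; case/setIP: xR.
  have [|E pE xE] := @predecessor_exists (phi X) [set x] (closed_phi X).
    by rewrite properEneq nxX.
  have : E \in predecessors phi (phi X) by rewrite inE.
  by rewrite XD => /set1P ED; rewrite sub1set ED (negPf xD) in xE.
case/negP: nRX; apply/eqP.
by apply: predecessor_card1_quasi_closed => //; apply: card1.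
Qed.

End Modular.

End ClosureOperator.

Theorem theorem2 (U : finType) (phi : {set U} -> {set U}) :
  closure_operator phi ->
  standard phi ->
  modular_closed_lattice phi ->
  (valid_E_base phi <->
   (forall C : {set U}, essential phi C -> ~~ join_irreducible phi C ->
    forall C' : {set U}, predecessor phi C C' ->
    #|C' :\: predecessor_meet phi C| = 1)).
Proof.
move=> clo std modl; split=> [val C essC njC C' pC'|].
  exact: valid_predecessor_card1.
exact: predecessor_card1_valid.
Qed.
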